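(* Let $\mathbf{D}_{\mathbf{Z}}$ and $\mathbf{K}_{\mathbf{Z}}$ be $m\times m$ positive definite matrices, let $\mathbf{K}^{*}$ be the maximizer of $\log|\mathbf{K}|$ over symmetric $\mathbf{K}$ with $\mathbf{0}\preccurlyeq\mathbf{K}\preccurlyeq\mathbf{D}_{\mathbf{Z}}$ and $\mathbf{K}\preccurlyeq\mathbf{K}_{\mathbf{Z}}$, and let $\mathbf{S}$ ($m\times r$) and $\mathbf{T}$ ($m\times l$) be matrices associated with $(\mathbf{D}_{\mathbf{Z}},\mathbf{K}_{\mathbf{Z}})$ as defined in the context (from a trace-minimizing pair of multipliers). Then: (a) if $r>0$, then $\mathbf{S}^T(\mathbf{K}_{\mathbf{Z}}-\mathbf{K}^{*})\mathbf{S}$ is strictly positive definite; (b) $[\mathbf{S},\mathbf{T}]$ is an invertible (square) matrix; (c) $[\mathbf{S},\mathbf{T}]$ is $\mathbf{K}^{*}$-orthogonal; (d) $\mathbf{S}$ is $\mathbf{D}_{\mathbf{Z}}$-orthogonal; (e) $\mathbf{T}$ is $\mathbf{K}_{\mathbf{Z}}$-orthogonal; (f) $\mathbf{S}$ and $\mathbf{T}$ are cross $\mathbf{D}_{\mathbf{Z}}$-orthogonal; (g) $\mathbf{S}$ and $\mathbf{T}$ are cross $\mathbf{K}_{\mathbf{Z}}$-orthogonal.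
   Context: $\mathbf{A}\preccurlyeq\mathbf{B}$ means $\mathbf{B}-\mathbf{A}$ is positive semidefinite. The maximizer $\mathbf{K}^{*}$ exists, is unique and is positive definite. Multipliers: $\mathcal{Q}$ is the set of all pairs $(\mathbf{M}_1,\mathbf{M}_2)$ of positive semidefinite $m\times m$ matrices satisfying the KKT conditions $$\mathbf{M}_1+\mathbf{M}_2=(\mathbf{K}^{*})^{-1},\qquad(\mathbf{D}_{\mathbf{Z}}-\mathbf{K}^{*})\mathbf{M}_1=\mathbf{0},\qquad(\mathbf{K}_{\mathbf{Z}}-\mathbf{K}^{*})\mathbf{M}_2=\mathbf{0}$$ (the multiplier of the constraint $\mathbf{K}\succcurlyeq\mathbf{0}$ is zero). $\mathcal{Q}$ is nonempty and compact. Let $(\bar{\mathbf{M}}_1,\bar{\mathbf{M}}_2)\in\mathcal{Q}$ be any pair minimizing $\mathrm{Trace}(\mathbf{M}_1)$ over $\mathcal{Q}$, and take spectral decompositions $\bar{\mathbf{M}}_1=\sum_{i=1}^r\lambda_i\mathbf{s}_i\mathbf{s}_i^T$, $\bar{\mathbf{M}}_2=\sum_{i=1}^l\gamma_i\mathbf{t}_i\mathbf{t}_i^T$ with $0\le r,l\le m$, all $\lambda_i,\gamma_j>0$, and $\{\mathbf{s}_i\}$, $\{\mathbf{t}_i\}$ each orthonormal. Set $$\mathbf{S}=[\sqrt{\lambda_1}\mathbf{s}_1,\dots,\sqrt{\lambda_r}\mathbf{s}_r],\qquad\mathbf{T}=[\sqrt{\gamma_1}\mathbf{t}_1,\dots,\sqrt{\gamma_l}\mathbf{t}_l].$$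 For a positive definite $m\times m$ matrix $\mathbf{B}$: an $m\times p$ matrix $\mathbf{U}$ is $\mathbf{B}$-orthogonal if $\mathbf{U}^T\mathbf{B}\mathbf{U}=\mathbf{I}_p$; an $m\times p$ matrix $\mathbf{U}$ and an $m\times q$ matrix $\mathbf{V}$ are cross $\mathbf{B}$-orthogonal if $\mathbf{U}^T\mathbf{B}\mathbf{V}=\mathbf{0}$. If $r=0$ (or $l=0$), $\mathbf{S}$ (or $\mathbf{T}$) is an empty matrix and statements about it are vacuous. *)

(* Defs.v *)
From HB Require Import structures.
From mathcomp Require Import all_boot all_order all_algebra.
From mathcomp Require Import all_classical all_reals all_analysis.

Set Implicit Arguments.
Unset Strict Implicit.
Unset Printing Implicit Defensive.

Import Order.TTheory GRing.Theory Num.Theory.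
Local Open Scope ring_scope.

(* Over the reals the sign of the quadratic form does not force symmetry, so
   symmetry is part of semidefiniteness and definiteness here. *)
Definition psd (R : realType) (n : nat) (A : 'M[R]_n) : Prop :=
  A^T = A /\ forall x : 'cV[R]_n, 0 <= (x^T *m A *m x) 0 0.

Definition pd (R : realType) (n : nat) (A : 'M[R]_n) : Prop :=
  A^T = A /\ forall x : 'cV[R]_n, x != 0 -> 0 < (x^T *m A *m x) 0 0.

Definition loewner_le (R : realType) (n : nat) (A B : 'M[R]_n) : Prop :=
  psd (B - A).

(* [ln] is total with [ln 0 = 0]; the extended-real [lne] gives the intended
   value -oo at singular feasible matrices. *)
Definition logdet (R : realType) (n : nat) (A : 'M[R]_n) : \bar R :=
  lne (\det A)%:E.

Definition feasible (R : realType) (m : nat) (DZ KZ K : 'M[R]_m) : Prop :=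
  [/\ K^T = K, loewner_le 0 K, loewner_le K DZ & loewner_le K KZ].

Definition is_maximizer (R : realType) (m : nat) (DZ KZ Kstar : 'M[R]_m) :
    Prop :=
  feasible DZ KZ Kstar /\
  forall K : 'M[R]_m, feasible DZ KZ K -> (logdet K <= logdet Kstar)%E.

(* M1 and M2 are the multipliers of K <= DZ and K <= KZ; the one of 0 <= K
   vanishes because the maximizer is positive definite. *)
Definition kkt_multipliers (R : realType) (m : nat)
    (DZ KZ Kstar M1 M2 : 'M[R]_m) : Prop :=
  [/\ psd M1, psd M2, M1 + M2 = invmx Kstar,
      (DZ - Kstar) *m M1 = 0 & (KZ - Kstar) *m M2 = 0].

Definition trace_minimizing (R : realType) (m : nat)
    (DZ KZ Kstar M1 M2 : 'M[R]_m) : Prop :=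
  kkt_multipliers DZ KZ Kstar M1 M2 /\
  forall N1 N2 : 'M[R]_m, kkt_multipliers DZ KZ Kstar N1 N2 ->
    \tr M1 <= \tr N1.

Definition orthonormal_family (R : realType) (m p : nat)
    (v : 'I_p -> 'cV[R]_m) : Prop :=
  forall i j : 'I_p, ((v i)^T *m v j) 0 0 = (i == j)%:R.

Definition spectral_decomposition (R : realType) (m p : nat) (M : 'M[R]_m)
    (lam : 'I_p -> R) (v : 'I_p -> 'cV[R]_m) : Prop :=
  [/\ forall i, 0 < lam i, orthonormal_family v
    & M = \sum_(i < p) lam i *: (v i *m (v i)^T)].

Definition weighted_columns (R : realType) (m p : nat)
    (lam : 'I_p -> R) (v : 'I_p -> 'cV[R]_m) : 'M[R]_(m, p) :=
  \matrix_(i < m, j < p) (Num.sqrt (lam j) * v j i 0).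

Definition B_orthogonal (R : realType) (m p : nat) (B : 'M[R]_m)
    (U : 'M[R]_(m, p)) : Prop :=
  U^T *m B *m U = 1%:M.

Definition cross_B_orthogonal (R : realType) (m p q : nat) (B : 'M[R]_m)
    (U : 'M[R]_(m, p)) (V : 'M[R]_(m, q)) : Prop :=
  U^T *m B *m V = 0.

(* An m x p matrix is square, and invertible once its width is read as m. *)
Definition square_invertible (R : realType) (m p : nat)
    (A : 'M[R]_(m, p)) : Prop :=
  exists e : p = m, castmx (erefl m, e) A \in unitmx.

(* Main.v *)
(* Moving the rank-one term [e (S x)(S x)^T] from [M1] to [M2] keeps the KKT
   conditions as soon as [(KZ - K) S x = 0], and lowers the trace of [M1]; hence
   trace minimality forces [S^T (KZ - K) S] to be definite.  Since
   [(KZ - K) T = 0], definiteness makes the columns of [U = [S, T]] independent,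
   and [U U^T = K^-1] then gives [U^T K U = 1]. *)
Require Import Defs.
From HB Require Import structures.
From mathcomp Require Import all_boot all_order all_algebra.
From mathcomp Require Import all_classical all_reals all_analysis.
From mathcomp Require Import ring lra.
Import Order.TTheory GRing.Theory Num.Theory.
Local Open Scope ring_scope.

Section RealMatrices.
Set Implicit Arguments.
Unset Strict Implicit.
Context {R : realType}.

(* Unlike [mxE], these leave matrix products folded. *)
Lemma entryD m n (A B : 'M[R]_(m, n)) i j : (A + B) i j = A i j + B i j.
Proof. by rewrite mxE. Qed.

Lemma entryN m n (A : 'M[R]_(m, n)) i j : (- A) i j = - A i j.
Proof. by rewrite mxE. Qed.

Lemma entryZ m n c (A : 'M[R]_(m, n)) i j : (c *: A) i j = c * A i j.
Proof. by rewrite mxE. Qed.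

Let entryE := (entryD, entryN, entryZ).

(** * Sums of squares and Gram matrices *)

Lemma cV_form_sum n (x : 'cV[R]_n) : (x^T *m x) 0 0 = \sum_i x i 0 ^+ 2.
Proof. by rewrite mxE; apply: eq_bigr => i _; rewrite mxE expr2. Qed.

Lemma cV_form_ge0 n (x : 'cV[R]_n) : 0 <= (x^T *m x) 0 0.
Proof. by rewrite cV_form_sum sumr_ge0 // => i _; rewrite sqr_ge0. Qed.

Lemma cV_form_eq0 n (x : 'cV[R]_n) : (x^T *m x) 0 0 = 0 -> x = 0.
Proof.
rewrite cV_form_sum => /eqP; rewrite psumr_eq0 => [/allP x0|i _]; last first.
  exact: sqr_ge0.
apply/colP => i; rewrite mxE; apply/eqP; rewrite -sqrf_eq0.
exact: x0 (mem_index_enum i).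
Qed.

Lemma gram_eq0 m n (A : 'M[R]_(m, n)) : A^T *m A = 0 -> A = 0.
Proof.
move=> A0; apply/matrixP => i j; rewrite [RHS]mxE.
have /cV_form_eq0/colP/(_ i) : ((col j A)^T *m col j A) 0 0 = 0.
  transitivity ((A^T *m A) j j); last by rewrite A0 mxE.
  by rewrite !mxE; apply: eq_bigr => k _; rewrite !mxE.
by rewrite !mxE.
Qed.

(** [A U (A U)^T = (A U U^T) A^T] vanishes. This carries complementary slackness from a multiplier
    to its factor [S] or [T]. *)
Lemma mulmx_gram_eq0 m n p (A : 'M[R]_(p, m)) (U : 'M[R]_(m, n)) :
  A *m (U *m U^T) = 0 -> A *m U = 0.
Proof.
move=> h; apply: trmx_inj; rewrite trmx0; apply: gram_eq0.
by rewrite trmxK trmx_mul mulmxA -(mulmxA A) h mul0mx.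
Qed.

Lemma form_congr m n (A : 'M[R]_m) (U : 'M[R]_(m, n)) (x : 'cV[R]_n) :
  x^T *m (U^T *m A *m U) *m x = (U *m x)^T *m A *m (U *m x).
Proof. by rewrite trmx_mul !mulmxA. Qed.

(** * Positive semidefinite and definite matrices *)

Lemma psd_congr m n (A : 'M[R]_m) (U : 'M[R]_(m, n)) :
  psd A -> psd (U^T *m A *m U).
Proof.
move=> [As Ap]; split; first by rewrite !trmx_mul trmxK As mulmxA.
by move=> x; rewrite form_congr.
Qed.

Lemma psdD n (A B : 'M[R]_n) : psd A -> psd B -> psd (A + B).
Proof.
move=> [As Ap] [Bs Bp]; split=> [|x]; first by rewrite linearD /= As Bs.
by rewrite mulmxDr mulmxDl mxE addr_ge0.
Qed.

Lemma psdZ n (c : R) (A : 'M[R]_n) : 0 <= c -> psd A -> psd (c *: A).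
Proof.
move=> c0 [As Ap]; split=> [|x]; first by rewrite linearZ /= As.
by rewrite -scalemxAr -scalemxAl mxE mulr_ge0.
Qed.

Lemma psd_gram m n (U : 'M[R]_(m, n)) : psd (U *m U^T).
Proof.
split=> [|x]; first by rewrite trmx_mul trmxK.
rewrite (_ : _ *m x = (U^T *m x)^T *m (U^T *m x)); first exact: cV_form_ge0.
by rewrite trmx_mul trmxK !mulmxA.
Qed.

(** With [y = A x], the form at [y + a x] is affine in [a] with slope [2 |A x|^2]; it stays
    nonnegative for every [a], so the slope is zero. *)
Lemma psd_form_eq0 n (A : 'M[R]_n) (x : 'cV[R]_n) :
  psd A -> (x^T *m A *m x) 0 0 = 0 -> A *m x = 0.
Proof.
move=> [As Ap] x0; apply: cV_form_eq0.
set y := A *m x; set N := (y^T *m y) 0 0; set c := (y^T *m A *m y) 0 0.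
apply/eqP/negPn/negP => N0.
have q (a : R) : 0 <= c + 2 * a * N.
  have := Ap (y + a *: x).
  rewrite [(_ + _)^T]linearD /= [(_ *: _)^T]linearZ /= !mulmxDl !mulmxDr.
  rewrite -!scalemxAl -!scalemxAr !entryE x0 -/c.
  have -> : (y^T *m A *m x) 0 0 = N by rewrite -mulmxA.
  have -> : (x^T *m A *m y) 0 0 = N by rewrite /N {3}/y trmx_mul As.
  lra.
have := q (- (c + 1) / (2 * N)).
rewrite (_ : c + _ = -1); first by rewrite lerNr oppr0 ler10.
by field.
Qed.

Lemma pd_psd n (A : 'M[R]_n) : pd A -> psd A.
Proof.
move=> [As Ap]; split=> // x; have [->|x0] := eqVneq x 0.
  by rewrite mulmx0 mxE.
exact/ltW/Ap.
Qed.

Lemma pdD n (A B : 'M[R]_n) : pd A -> pd B -> pd (A + B).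
Proof.
move=> [As Ap] [Bs Bp]; split=> [|x x0]; first by rewrite linearD /= As Bs.
by rewrite mulmxDr mulmxDl mxE addr_gt0 ?Ap ?Bp.
Qed.

Lemma pd_unit n (A : 'M[R]_n) : pd A -> A \in unitmx.
Proof.
move=> [As Ap]; rewrite unitmxE unitfE; apply/negP => /det0P[v v0 vA].
have vT0 : v^T != 0.
  by apply: contra_neq v0 => /(congr1 trmx); rewrite trmxK trmx0.
by have := Ap _ vT0; rewrite trmxK vA mul0mx mxE ltxx.
Qed.

Lemma psd_inv n (A : 'M[R]_n) : A \in unitmx -> psd A -> psd (invmx A).
Proof.
move=> Au Ap; have [As _] := Ap.
have := psd_congr (invmx A) Ap.
by rewrite trmx_inv As mulVmx // mul1mx.
Qed.

Lemma pd1 n : pd (1%:M : 'M[R]_n).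
Proof.
split=> [|x x0]; first exact: trmx1.
rewrite mulmx1 lt_neqAle cV_form_ge0 andbT eq_sym.
by apply: contra_neq x0; apply: cV_form_eq0.
Qed.

Lemma pdZ n (c : R) (A : 'M[R]_n) : 0 < c -> pd A -> pd (c *: A).
Proof.
move=> c0 [As Ap]; split=> [|x x0]; first by rewrite linearZ /= As.
by rewrite -scalemxAr -scalemxAl mxE mulr_gt0 ?Ap.
Qed.

(** * Determinants and invertibility of the maximizer *)

(* The determinant has no zero along the segment from [1] to [A]. *)
Lemma pd_det_gt0 n (A : 'M[R]_n) : pd A -> 0 < \det A.
Proof.
move=> Ap; rewrite ltNge; apply/negP => detA.
pose q := \det (map_mx polyC 1%:M + 'X *: map_mx polyC (A - 1%:M)).
have qE t : q.[t] = \det ((1 - t) *: 1%:M + t *: A).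
  rewrite -[LHS]/(horner_eval t q) /q -det_map_mx; congr (\det _).
  by apply/matrixP => i j; rewrite !mxE /= /horner_eval !hornerE; ring.
have [||t /andP[t0 t1] /rootP] := @poly_ivt R (- q) 0 1; first exact: ler01.
  rewrite !hornerN !qE subr0 subrr !scale0r !scale1r addr0 add0r det1.
  by rewrite lerN10 oppr_ge0.
rewrite hornerN => /eqP; rewrite oppr_eq0 qE => /eqP det0.
suff /pd_unit : pd ((1 - t) *: 1%:M + t *: A).
  by rewrite unitmxE det0 unitr0.
(* The endpoints are treated apart because [pdZ] needs strictly positive weights. *)
have [->|tn0] := eqVneq t 0.
  by rewrite subr0 scale1r scale0r addr0; apply: pd1.
have [->|tn1] := eqVneq t 1.
  by rewrite subrr scale1r scale0r add0r.
have t_gt0 : 0 < t by rewrite lt_neqAle eq_sym tn0.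
have t_lt1 : 0 < 1 - t by rewrite subr_gt0 lt_neqAle tn1.
exact: pdD (pdZ t_lt1 (pd1 n)) (pdZ t_gt0 Ap).
Qed.

(* The witness is the parallel sum [(P^-1 + Q^-1)^-1]. *)
Lemma feasible_det_gt0_ex n (P Q : 'M[R]_n) :
  pd P -> pd Q -> exists2 K, feasible P Q K & 0 < \det K.
Proof.
move=> Pp Qp; have PQp := pdD Pp Qp; have PQu := pd_unit PQp.
have Gp := psd_inv PQu (pd_psd PQp).
set G := invmx (P + Q) in Gp.
have [Ps _] := Pp; have [Qs _] := Qp; have [Gs _] := Gp.
(* The parallel sum is [P G Q]; [eP] and [eQ] give its gaps to [P] and [Q] as the congruences
   [P G P] and [Q G Q] of [G]. *)
have eP : P *m G *m Q = P - P *m G *m P.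
  apply/eqP; rewrite eq_sym subr_eq -mulmxDr addrC.
  by rewrite -mulmxA mulVmx ?mulmx1.
have eQ : P *m G *m Q = Q - Q *m G *m Q.
  apply/eqP; rewrite eq_sym subr_eq -!mulmxA -mulmxDl mulmxA.
  by rewrite mulmxV ?mul1mx.
have Ks : (P *m G *m Q)^T = P *m G *m Q.
  by rewrite {1}eP linearB /= !trmx_mul Ps Gs mulmxA -eP.
(* As [Q G P = P G Q], the right-hand side collapses to [P G Q G (Q + P) = P G Q]. *)
have Kp : P *m G *m Q =
    (G *m Q)^T *m P *m (G *m Q) + (G *m P)^T *m Q *m (G *m P).
  have QGP : Q *m G *m P = P *m G *m Q.
    by rewrite -[RHS]Ks !trmx_mul Ps Gs Qs mulmxA.
  rewrite !trmx_mul Ps Gs Qs !mulmxA QGP -!mulmxA -!mulmxDr.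
  by rewrite [Q + P]addrC mulVmx ?mulmx1.
exists (P *m G *m Q).
  split=> //; rewrite /loewner_le.
  - rewrite subr0 Kp.
    by apply: psdD; apply: psd_congr; apply: pd_psd.
  - rewrite eP opprB addrC subrK -{1}Ps.
    exact: psd_congr.
  - rewrite eQ opprB addrC subrK -{1}Qs.
    exact: psd_congr.
by rewrite !det_mulmx det_inv !mulr_gt0 ?invr_gt0 ?pd_det_gt0.
Qed.

(** A singular matrix has [logdet] equal to [-oo], and a feasible matrix of positive determinant
    beats it. *)
Lemma maximizer_unit n (P Q K : 'M[R]_n) :
  pd P -> pd Q -> is_maximizer P Q K -> K \in unitmx.
Proof.
move=> Pp Qp [_ Kmax]; have [K0 /Kmax K0K detK0] := feasible_det_gt0_ex Pp Qp.
rewrite unitmxE unitfE; apply: contraTN K0K => /eqP detK.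
by rewrite /logdet detK (lne_EFin detK0) le0_lneNy // leeNy_eq.
Qed.

(** * Factors of the multipliers *)

Lemma weighted_columns_gram m p (lam : 'I_p -> R) (v : 'I_p -> 'cV[R]_m) M :
  spectral_decomposition M lam v ->
  weighted_columns lam v *m (weighted_columns lam v)^T = M.
Proof.
move=> [lam0 _ ->]; apply/matrixP => i j.
rewrite summxE mxE; apply: eq_bigr => k _.
rewrite !mxE big_ord1 !mxE mulrACA -expr2 sqr_sqrtr //.
exact/ltW/lam0.
Qed.

(** Orthonormality makes [V^T V] the diagonal matrix of the positive weights. *)
Lemma weighted_columns_inj m p (lam : 'I_p -> R) (v : 'I_p -> 'cV[R]_m) M
    (x : 'cV[R]_p) :
  spectral_decomposition M lam v -> weighted_columns lam v *m x = 0 -> x = 0.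
Proof.
move=> [lam0 ov _] Vx.
have VV : (weighted_columns lam v)^T *m weighted_columns lam v
    = diag_mx (\row_j lam j).
  apply/matrixP => i j; rewrite !mxE.
  under eq_bigr do rewrite !mxE mulrACA.
  rewrite -mulr_sumr.
  have := ov i j; rewrite mxE.
  under eq_bigr do rewrite mxE.
  move=> ->; case: eqVneq => [->|_]; last by rewrite mulr0.
  by rewrite mulr1 -expr2 sqr_sqrtr //; apply/ltW/lam0.
apply/colP => i; have /colP/(_ i) : diag_mx (\row_j lam j) *m x = 0.
  by rewrite -VV -mulmxA Vx mulmx0.
rewrite mul_diag_mx !mxE => /eqP; rewrite mulf_eq0 gt_eqF //=.
by move/eqP.
Qed.

Lemma free_square_invertible m n (A : 'M[R]_(m, n)) :
  row_free A -> row_free A^T -> square_invertible A.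
Proof.
move=> Af Atf.
have e : n = m.
  apply/eqP; rewrite eqn_leq; apply/andP; split.
    by move/eqP: Atf => <-; apply: rank_leq_col.
  by move/eqP: Af => <-; apply: rank_leq_col.
(* Eliminating [e] turns the cast into the identity. *)
exists e; move: Af {Atf}; case: m / e A => A Af.
by rewrite castmx_id -row_free_unit.
Qed.

(* With [e = 1 / (1 + |x|^2)], [1 - e x x^T] is still positive semidefinite. *)
Lemma gram_sub_psd m n (U : 'M[R]_(m, n)) (x : 'cV[R]_n) :
  exists2 e : R, 0 < e & psd (U *m U^T - e *: (U *m x *m (U *m x)^T)).
Proof.
set N := (x^T *m x) 0 0; have N0 : 0 <= N := cV_form_ge0 x.
pose e := (1 + N)^-1; exists e; first by rewrite invr_gt0; lra.
have -> : U *m U^T - e *: (U *m x *m (U *m x)^T)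
   = U^T^T *m (1%:M - e *: (x *m x^T)) *m U^T.
  rewrite trmxK mulmxBr mulmxBl mulmx1 -scalemxAr -scalemxAl trmx_mul.
  by rewrite !mulmxA.
apply: psd_congr; split=> [|y].
  by rewrite linearB linearZ /= trmx1 trmx_mul trmxK.
set p := (x^T *m y) 0 0; set Y := (y^T *m y) 0 0.
have yx : (y^T *m x) 0 0 = p.
  by rewrite /p !mxE; apply: eq_bigr => k _; rewrite !mxE mulrC.
have -> : (y^T *m (1%:M - e *: (x *m x^T)) *m y) 0 0 = Y - e * p ^+ 2.
  rewrite mulmxBr mulmxBl mulmx1 -scalemxAr -scalemxAl !entryE -/Y.
  congr (_ - _ * _).
  rewrite mulmxA -[y^T *m x *m _ *m _]mulmxA (mx11_scalar (y^T *m x)) yx.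
  by rewrite mul_scalar_mx mxE expr2.
(* This is [|y - e p x|^2]. Since [e N = 1 - e], it equals [Y - e p^2 - (e p)^2], so the form is at
   least [(e p)^2]. *)
have : 0 <= Y - 2 * e * p ^+ 2 + e ^+ 2 * p ^+ 2 * N.
  have := cV_form_ge0 (y - (e * p) *: x).
  rewrite [(_ - _)^T]linearB /= [(_ *: _)^T]linearZ /= mulmxBl !mulmxBr.
  rewrite -!scalemxAl -!scalemxAr !entryE -/Y -/N -/p yx.
  lra.
have eN : e * N = 1 - e by rewrite /e; field; lra.
have : 0 <= (e * p) ^+ 2 by exact: sqr_ge0.
rewrite (_ : e ^+ 2 * p ^+ 2 * N = e * p ^+ 2 * (e * N)); last by ring.
rewrite eN; lra.
Qed.

End RealMatrices.

(** * Trace minimality and the orthogonality relations *)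

Theorem theorem2 (R : realType) (m : nat) (DZ KZ Kstar : 'M[R]_m)
    (hDZ : pd DZ) (hKZ : pd KZ) (hKstar : is_maximizer DZ KZ Kstar)
    (M1 M2 : 'M[R]_m) (hM : trace_minimizing DZ KZ Kstar M1 M2)
    (r l : nat) (hr : (r <= m)%N) (hl : (l <= m)%N)
    (lam : 'I_r -> R) (s : 'I_r -> 'cV[R]_m)
    (gam : 'I_l -> R) (t : 'I_l -> 'cV[R]_m)
    (hM1 : spectral_decomposition M1 lam s)
    (hM2 : spectral_decomposition M2 gam t)
    (S : 'M[R]_(m, r)) (T : 'M[R]_(m, l))
    (hS : S = weighted_columns lam s) (hT : T = weighted_columns gam t) :
  ((0 < r)%N -> pd (S^T *m (KZ - Kstar) *m S)) /\
  square_invertible (row_mx S T) /\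
  B_orthogonal Kstar (row_mx S T) /\
  B_orthogonal DZ S /\
  B_orthogonal KZ T /\
  cross_B_orthogonal DZ S T /\
  cross_B_orthogonal KZ S T.
Proof.
have Ku := maximizer_unit hDZ hKZ hKstar.
have [[Ks _ DKp KKp] _] := hKstar.
have [[M1p M2p M12 DM1 KM2] Mmin] := hM.
have SS : S *m S^T = M1 by rewrite hS; apply: weighted_columns_gram hM1.
have TT : T *m T^T = M2 by rewrite hT; apply: weighted_columns_gram hM2.
have DS : (DZ - Kstar) *m S = 0 by apply: mulmx_gram_eq0; rewrite SS.
have KT : (KZ - Kstar) *m T = 0 by apply: mulmx_gram_eq0; rewrite TT.
have Spd : pd (S^T *m (KZ - Kstar) *m S).
  have [sym pos] := psd_congr S KKp.
  split=> // x x0; rewrite lt_neqAle pos andbT eq_sym; apply/eqP => q0.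
  have KSx : (KZ - Kstar) *m (S *m x) = 0.
    by apply: psd_form_eq0 => //; rewrite -form_congr.
  have [e e0 M1e] := gram_sub_psd S x.
  set w := S *m x in KSx M1e.
  have /Mmin : kkt_multipliers DZ KZ Kstar
      (S *m S^T - e *: (w *m w^T)) (M2 + e *: (w *m w^T)).
    split=> //.
    - by apply: psdD => //; apply: psdZ (ltW e0) _; apply: psd_gram.
    - by rewrite SS addrACA addNr addr0.
    - by rewrite mulmxBr -scalemxAr /w !mulmxA DS !mul0mx scaler0 subr0.
    - by rewrite mulmxDr KM2 -scalemxAr mulmxA KSx mul0mx scaler0 addr0.
  (* The new trace is [tr M1 - e |w|^2], so minimality forces [w = S x = 0], against the injectivity
     of [S]. *)
  rewrite SS linearB linearZ /= mxtrace_mulC trace_mx11.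
  rewrite lerBrDr gerDl pmulr_rle0 // => w0.
  have /cV_form_eq0 w_eq0 : (w^T *m w) 0 0 = 0.
    by apply/eqP; rewrite eq_le w0 cV_form_ge0.
  move/eqP: x0; apply; apply: weighted_columns_inj hM1 _.
  by rewrite -hS.
have UU : row_mx S T *m (row_mx S T)^T = invmx Kstar.
  by rewrite tr_row_mx mul_row_col SS TT.
(* Applying [KZ - Kstar] to [S y + T z = 0] removes [T z]; definiteness then gives [y = 0], and
   injectivity of [T] gives [z = 0]. *)
have Uinj (x : 'cV_(r + l)) : row_mx S T *m x = 0 -> x = 0.
  rewrite -(vsubmxK x) mul_row_col; set y := usubmx x; set z := dsubmx x.
  move=> yz.
  have y0 : y = 0.
    apply/eqP/negPn/negP => /(proj2 Spd).
    have KSy : (KZ - Kstar) *m (S *m y) = 0.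
      rewrite -[S *m y](addrK (T *m z)) yz sub0r mulmxN mulmxA KT mul0mx.
      by rewrite oppr0.
    by rewrite form_congr -mulmxA KSy mulmx0 mxE ltxx.
  move: yz; rewrite y0 mulmx0 add0r hT => /(weighted_columns_inj hM2) ->.
  exact: col_mx0.
have Utf : row_free (row_mx S T)^T.
  apply: inj_row_free => v vU; apply: trmx_inj; rewrite trmx0.
  by apply: Uinj; rewrite -[row_mx S T]trmxK -trmx_mul vU trmx0.
have Uf : row_free (row_mx S T).
  apply/row_freeP; exists ((row_mx S T)^T *m Kstar).
  by rewrite mulmxA UU mulVmx.
(* Multiplied on the right by [U^T], both sides become [U^T], which can be cancelled because its
   rows are free. *)
have Uo : B_orthogonal Kstar (row_mx S T).
  apply: (row_free_inj Utf); rewrite /= mul1mx.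
  by rewrite -!mulmxA UU mulmxV ?mulmx1.
have := Uo; rewrite {1}/B_orthogonal {1}tr_row_mx mul_col_mx mul_col_row.
rewrite {1}scalar_mx_block => /eq_block_mx[SKS SKT _ TKT].
(* By slackness [DZ] acts as [Kstar] on [S], and [KZ] does on [T], so the blocks of
   [U^T Kstar U = 1] give the remaining claims. *)
have congr_eq p q (A : 'M[R]_m) (U : 'M[R]_(m, p)) (V : 'M[R]_(m, q)) :
    (A - Kstar) *m V = 0 -> U^T *m A *m V = U^T *m Kstar *m V.
  by rewrite mulmxBl => /eqP; rewrite subr_eq0 -!mulmxA => /eqP ->.
split; first by [].
split; first exact: free_square_invertible.
split; first by [].
split; first by rewrite /B_orthogonal congr_eq.
split; first by rewrite /B_orthogonal congr_eq.
split; last by rewrite /cross_B_orthogonal congr_eq.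
(* Slackness for [DZ] concerns [S] only, so [S] is brought to the right by transposing. *)
apply: trmx_inj; rewrite trmx0 !trmx_mul trmxK mulmxA.
have [DZs _] := hDZ.
by rewrite DZs congr_eq // -{1}Ks -[S]trmxK -!trmx_mul mulmxA SKT trmx0.
Qed.
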